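(* Let $\mathbb{M}\in\{\mathsf K,\mathsf D,\mathsf T,\mathsf{K4},\mathsf{S4}\}$. If the 2-sequent $\Gamma\vdash\Delta$ is derivable in $2_{\mathbb{M}}$, then $\Gamma\models_{\mathbb{M}}\Delta$.
   Context: Modal formulas over proposition symbols (set $At$) with $\neg,\wedge,\vee,\to,\Box,\Diamond$. Fix a countably infinite set of tokens; a position is a finite (possibly empty) sequence of tokens, $\circ$ concatenation, $\alpha\circ x=\alpha\circ\langle x\rangle$, $\beta\preceq\alpha$ means $\beta$ is a prefix of $\alpha$. A p-formula is $A^\alpha$; a 2-sequent is $\Gamma\vdash\Delta$ with $\Gamma,\Delta$ finite sequences of p-formulas; $I(\Gamma)=\{\beta:\exists A^\alpha\in\Gamma,\ \beta\preceq\alpha\}$. Calculus $2_{\mathsf{S4}}$: Axiom $A^\alpha\vdash A^\alpha$; Cut: from $\Gamma_1\vdash A^\alpha,\Delta_1$ and $\Gamma_2,A^\alpha\vdash\Delta_2$ infer $\Gamma_1,\Gamma_2\vdash\Delta_1,\Delta_2$; weakening, contraction, exchange; classical propositional sequent rules for $\neg,\wedge,\vee,\to$ with all active p-formulas at the same position; modal rules: ($\Box\vdash$) from $\Gamma,A^{\alpha\circ\beta}\vdash\Delta$ infer $\Gamma,(\Box A)^\alpha\vdash\Delta$; ($\vdash\Box$) from $\Gamma\vdash A^{\alpha\circ x},\Delta$ infer $\Gamma\vdash(\Box A)^\alpha,\Delta$; ($\Diamond\vdash$) from $\Gamma,A^{\alpha\circ x}\vdash\Delta$ infer $\Gamma,(\Diamond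 A)^\alpha\vdash\Delta$; ($\vdash\Diamond$) from $\Gamma\vdash A^{\alpha\circ\beta},\Delta$ infer $\Gamma\vdash(\Diamond A)^\alpha,\Delta$; $\beta$ a position, $x$ a token, and in $\vdash\Box,\Diamond\vdash$, $\alpha\circ x\notin I(\Gamma,\Delta)$. $2_{\mathsf T},2_{\mathsf D},2_{\mathsf{K4}},2_{\mathsf K}$ add constraints on $\Box\vdash,\vdash\Diamond$: $2_{\mathsf T}$: $\beta$ empty or a single token; $2_{\mathsf D}$: $\beta$ a single token; $2_{\mathsf{K4}}$: $\beta$ nonempty and $\Gamma$ or $\Delta$ contains some $B^{\alpha\circ\beta\circ\eta}$; $2_{\mathsf K}$: $\beta$ a single token and $\Gamma$ or $\Delta$ contains some $B^{\alpha\circ\beta\circ\eta}$. In $2_{\mathsf K},2_{\mathsf{K4}}$ Cut requires $\alpha\in I(\Gamma_1,\Delta_1)$ or $\alpha\in I(\Gamma_2,\Delta_2)$. Semantics: a tree is a set $\Theta$ of finite sequences of natural numbers containing $\langle\,\rangle$ and closed under prefixes. For nodes, $s\lhd t$ iff $t=s\circ\langle k\rangle$ for some $k$; $\lhd^0$ is its reflexive closure, $\lhd^+$ its transitive closure, $\unlhd$ its reflexive-transitive closure. A Kripke model is $\langle\Theta,\nu,R\rangle$ with $\nu:\Theta\to 2^{At}$, $R\subseteq\Theta\times\Theta$, with the standard forcing relation ($s\models\Box A$ iff $t\models A$ for all $t$ with $sRt$, $s\models\Diamond A$ iff some such $t$ forces $A$). It is a $\mathsf K$-model if $R=\lhd$;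 a $\mathsf D$-model if $\Theta$ has no leaves and $R=\lhd$; a $\mathsf T$-model if $R=\lhd^0$; a $\mathsf{K4}$-model if $R=\lhd^+$; an $\mathsf{S4}$-model if $R=\unlhd$. A $2_{\mathbb M}$ structure is a pair of an $\mathbb M$-model and a partial map $\rho$ from positions to $\Theta$ such that $\rho(\alpha)$ defined implies $\rho(\beta)$ defined for every prefix $\beta$ of $\alpha$, and moreover, writing $\alpha\lhd\beta$ for $\beta=\alpha\circ x$ with $x$ a token: for $\mathsf K$, if $\alpha\lhd\beta$ and both $\rho(\alpha),\rho(\beta)$ are defined then $\rho(\alpha)\lhd\rho(\beta)$; for $\mathsf{K4}$, same with $\rho(\alpha)\lhd^+\rho(\beta)$; for $\mathsf D$, $\rho$ is total and $\alpha\lhd\beta\Rightarrow\rho(\alpha)\lhd\rho(\beta)$; for $\mathsf T$, $\rho$ total and $\alpha\lhd\beta\Rightarrow\rho(\alpha)\lhd^0\rho(\beta)$; for $\mathsf{S4}$, $\rho$ total and $\alpha\lhd\beta\Rightarrow\rho(\alpha)\unlhd\rho(\beta)$. Define $\rho\models^\ell A^\alpha$ iff $\rho(\alpha)$ is defined and $\rho(\alpha)\models A$; $\rho\models^r A^\alpha$ iff ($\rho(\alpha)$ defined implies $\rho(\alpha)\models A$). A structure satisfies $\Gamma\vdash\Delta$ iff, whenever $\rho\models^\ell A^\alpha$ for all $A^\alpha\in\Gamma$, there is $B^\beta\in\Delta$ with $\rho\models^r B^\beta$. $\Gamma\models_{\mathbb M}\Delta$ means every $2_{\mathbb M}$ structure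 satisfies $\Gamma\vdash\Delta$. *)

(* Defs.v *)
From Stdlib Require Import List Relations.
Import ListNotations.

Set Implicit Arguments.

Definition prefix (X : Type) (s t : list X) : Prop := exists u, t = s ++ u.

Inductive logic : Set := K | D | T | K4 | S4.

(** * Syntax *)

Inductive form (At : Type) : Type :=
| Atom (p : At)
| Neg (A : form At)
| And (A B : form At)
| Or (A B : form At)
| Imp (A B : form At)
| Box (A : form At)
| Dia (A : form At).

Definition token : Set := nat.
Definition position : Set := list token.

Record pform (At : Type) : Type :=
  PForm { pf_form : form At; pf_pos : position }.

Notation "A ^^ α" := (PForm A α) (at level 25, no associativity).

(** [init Γ β] is [β ∈ I(Γ)], and [init (Γ ++ Δ) β] is [β ∈ I(Γ, Δ)]. *)
Definition init (At : Type) (Γ : list (pform At)) (β : position) : Prop :=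
  exists A α, In (A ^^ α) Γ /\ prefix β α.

(** * The calculi *)

(** The constraint on [β] in the rules (□ ⊢) and (⊢ ◇), whose principal
    formula is at [α] and whose active formula is at [α ++ β]. *)
Definition modal_side (At : Type) (M : logic) (α β : position)
    (Γ Δ : list (pform At)) : Prop :=
  let occurs :=
    exists B η, In (B ^^ (α ++ β ++ η)) Γ \/ In (B ^^ (α ++ β ++ η)) Δ in
  match M with
  | S4 => True
  | T => β = [] \/ exists x, β = [x]
  | D => exists x, β = [x]
  | K4 => β <> [] /\ occurs
  | K => (exists x, β = [x]) /\ occurs
  end.

Definition cut_side (At : Type) (M : logic) (α : position)
    (Γ1 Δ1 Γ2 Δ2 : list (pform At)) : Prop :=
  match M with
  | K | K4 => init (Γ1 ++ Δ1) α \/ init (Γ2 ++ Δ2) α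
  | D | T | S4 => True
  end.

(** The propositional rules are those of Gentzen's LK, with contexts
    concatenated in the two-premise rules, as in Cut. *)
Inductive derivable (At : Type) (M : logic) :
    list (pform At) -> list (pform At) -> Prop :=
| d_ax A α :
    derivable M [A ^^ α] [A ^^ α]
| d_cut A α Γ1 Γ2 Δ1 Δ2 :
    cut_side M α Γ1 Δ1 Γ2 Δ2 ->
    derivable M Γ1 (A ^^ α :: Δ1) ->
    derivable M (Γ2 ++ [A ^^ α]) Δ2 ->
    derivable M (Γ1 ++ Γ2) (Δ1 ++ Δ2)
| d_weakL A α Γ Δ :
    derivable M Γ Δ ->
    derivable M (Γ ++ [A ^^ α]) Δ
| d_weakR A α Γ Δ :
    derivable M Γ Δ ->
    derivable M Γ (A ^^ α :: Δ)
| d_contrL A α Γ Δ :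
    derivable M (Γ ++ [A ^^ α; A ^^ α]) Δ ->
    derivable M (Γ ++ [A ^^ α]) Δ
| d_contrR A α Γ Δ :
    derivable M Γ (A ^^ α :: A ^^ α :: Δ) ->
    derivable M Γ (A ^^ α :: Δ)
| d_exchL A α B β Γ1 Γ2 Δ :
    derivable M (Γ1 ++ A ^^ α :: B ^^ β :: Γ2) Δ ->
    derivable M (Γ1 ++ B ^^ β :: A ^^ α :: Γ2) Δ
| d_exchR A α B β Γ Δ1 Δ2 :
    derivable M Γ (Δ1 ++ A ^^ α :: B ^^ β :: Δ2) ->
    derivable M Γ (Δ1 ++ B ^^ β :: A ^^ α :: Δ2)
| d_negL A α Γ Δ :
    derivable M Γ (A ^^ α :: Δ) ->
    derivable M (Γ ++ [Neg A ^^ α]) Δ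
| d_negR A α Γ Δ :
    derivable M (Γ ++ [A ^^ α]) Δ ->
    derivable M Γ (Neg A ^^ α :: Δ)
| d_andL1 A B α Γ Δ :
    derivable M (Γ ++ [A ^^ α]) Δ ->
    derivable M (Γ ++ [And A B ^^ α]) Δ
| d_andL2 A B α Γ Δ :
    derivable M (Γ ++ [B ^^ α]) Δ ->
    derivable M (Γ ++ [And A B ^^ α]) Δ
| d_andR A B α Γ1 Γ2 Δ1 Δ2 :
    derivable M Γ1 (A ^^ α :: Δ1) ->
    derivable M Γ2 (B ^^ α :: Δ2) ->
    derivable M (Γ1 ++ Γ2) (And A B ^^ α :: Δ1 ++ Δ2)
| d_orL A B α Γ1 Γ2 Δ1 Δ2 :
    derivable M (Γ1 ++ [A ^^ α]) Δ1 ->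
    derivable M (Γ2 ++ [B ^^ α]) Δ2 ->
    derivable M (Γ1 ++ Γ2 ++ [Or A B ^^ α]) (Δ1 ++ Δ2)
| d_orR1 A B α Γ Δ :
    derivable M Γ (A ^^ α :: Δ) ->
    derivable M Γ (Or A B ^^ α :: Δ)
| d_orR2 A B α Γ Δ :
    derivable M Γ (B ^^ α :: Δ) ->
    derivable M Γ (Or A B ^^ α :: Δ)
| d_impL A B α Γ1 Γ2 Δ1 Δ2 :
    derivable M Γ1 (A ^^ α :: Δ1) ->
    derivable M (Γ2 ++ [B ^^ α]) Δ2 ->
    derivable M (Γ1 ++ Γ2 ++ [Imp A B ^^ α]) (Δ1 ++ Δ2)
| d_impR A B α Γ Δ :
    derivable M (Γ ++ [A ^^ α]) (B ^^ α :: Δ) ->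
    derivable M Γ (Imp A B ^^ α :: Δ)
| d_boxL A α β Γ Δ :
    modal_side M α β Γ Δ ->
    derivable M (Γ ++ [A ^^ (α ++ β)]) Δ ->
    derivable M (Γ ++ [Box A ^^ α]) Δ
| d_boxR A α x Γ Δ :
    ~ init (Γ ++ Δ) (α ++ [x]) ->
    derivable M Γ (A ^^ (α ++ [x]) :: Δ) ->
    derivable M Γ (Box A ^^ α :: Δ)
| d_diaL A α x Γ Δ :
    ~ init (Γ ++ Δ) (α ++ [x]) ->
    derivable M (Γ ++ [A ^^ (α ++ [x])]) Δ ->
    derivable M (Γ ++ [Dia A ^^ α]) Δ
| d_diaR A α β Γ Δ :
    modal_side M α β Γ Δ ->
    derivable M Γ (A ^^ (α ++ β) :: Δ) ->
    derivable M Γ (Dia A ^^ α :: Δ).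

(** * Semantics *)

Definition node : Set := list nat.

Definition is_tree (Θ : node -> Prop) : Prop :=
  Θ [] /\ forall s t, prefix s t -> Θ t -> Θ s.

Definition child (Θ : node -> Prop) (s t : node) : Prop :=
  Θ s /\ Θ t /\ exists k, t = s ++ [k].

(** [val] is meaningful only at nodes of [tree]; [acc] holds only between
    nodes of [tree]. *)
Record model (At : Type) : Type := Model {
  tree : node -> Prop;
  val : node -> At -> Prop;
  acc : node -> node -> Prop;
  treeP : is_tree tree;
  accP : forall s t, acc s t -> tree s /\ tree t
}.

Fixpoint forces (At : Type) (N : model At) (s : node) (A : form At) : Prop :=
  match A with
  | Atom p => val N s p
  | Neg A => ~ forces N s A
  | And A B => forces N s A /\ forces N s B
  | Or A B => forces N s A \/ forces N s B
  | Imp A B => forces N s A -> forces N s B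
  | Box A => forall t, acc N s t -> forces N t A
  | Dia A => exists t, acc N s t /\ forces N t A
  end.

(** The relation on the nodes of [Θ] attached to each logic. It serves both
    as the accessibility relation of models and as the constraint on the
    interpretation of positions. *)
Definition logic_rel (M : logic) (Θ : node -> Prop) : relation node :=
  match M with
  | K | D => child Θ
  | T => clos_refl node (child Θ)
  | K4 => clos_trans node (child Θ)
  | S4 => clos_refl_trans node (child Θ)
  end.

(** Outside [Θ] the reflexive closures still relate each list to itself, hence
    the restriction to nodes of the tree. *)
Definition is_model (At : Type) (M : logic) (N : model At) : Prop :=
  (forall s t, acc N s t <-> tree N s /\ tree N t /\ logic_rel M (tree N) s t)
  /\ (M = D -> forall s, tree N s -> exists t, child (tree N) s t).

Definition defined (ρ : position -> option node) (α : position) : Prop :=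
  exists s, ρ α = Some s.

Definition total_logic (M : logic) : Prop :=
  match M with
  | K | K4 => False
  | D | T | S4 => True
  end.

Record structure (At : Type) (M : logic) : Type := Structure {
  smodel : model At;
  rho : position -> option node;
  smodelP : is_model M smodel;
  rho_tree : forall α s, rho α = Some s -> tree smodel s;
  rho_prefix : forall α β, prefix β α -> defined rho α -> defined rho β;
  rho_step : forall α x s t, rho α = Some s -> rho (α ++ [x]) = Some t ->
    logic_rel M (tree smodel) s t;
  rho_total : total_logic M -> forall α, defined rho α
}.

Definition satL (At : Type) (M : logic) (S : structure At M)
    (P : pform At) : Prop :=
  exists s, rho S (pf_pos P) = Some s /\ forces (smodel S) s (pf_form P).

Definition satR (At : Type) (M : logic) (S : structure At M)
    (P : pform At) : Prop :=
  forall s, rho S (pf_pos P) = Some s -> forces (smodel S) s (pf_form P).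

Definition satisfies (At : Type) (M : logic) (S : structure At M)
    (Γ Δ : list (pform At)) : Prop :=
  (forall P, In P Γ -> satL S P) -> exists Q, In Q Δ /\ satR S Q.

Definition entails (At : Type) (M : logic) (Γ Δ : list (pform At)) : Prop :=
  forall S : structure At M, satisfies S Γ Δ.

(* Main.v *)
Require Import Defs.
From Stdlib Require Import List.
From Stdlib Require Import Relations PeanoNat Classical ClassicalEpsilon.
Import ListNotations.

Set Implicit Arguments.

(** A 2-sequent fails in a structure exactly when all its positions are
    interpreted, its left-hand formulas hold and its right-hand formulas do not.
    By induction on derivations, a structure refuting the conclusion of a rule
    yields one refuting a premise. For (□ ⊢) and (⊢ ◇) the side condition, or
    totality, makes [ρ (α ++ β)] defined and related to [ρ α]. For (⊢ □) and
    (◇ ⊢) the witness [t] of the modality becomes the value of [α ++ [x]]; the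
    whole cone above [α ++ [x]] is reinterpreted, which by freshness changes no
    other position of the sequent. In total logics the cone is sent to a path
    of successive related nodes from [t], in partial ones it is cut off at
    [α ++ [x]]. *)

(** * Reinterpreting a cone of positions *)

(** Membership in the cone above [p], tested computably and returning the part of [l] beyond [p]. *)
Fixpoint strip (p l : position) : option position :=
  match p, l with
  | [], _ => Some l
  | x :: p, y :: l => if Nat.eq_dec x y then strip p l else None
  | _ :: _, [] => None
  end.

Lemma strip_app p u : strip p (p ++ u) = Some u.
Proof.
  induction p as [|x p IH]; simpl; auto.
  destruct (Nat.eq_dec x x); congruence.
Qed.

Lemma strip_Some p l u : strip p l = Some u -> l = p ++ u.
Proof.
  revert l; induction p as [|x p IH]; intros [|y l]; simpl; try congruence.
  destruct (Nat.eq_dec x y); [intros H; apply IH in H|]; congruence.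
Qed.

Lemma strip_None p l : ~ prefix p l -> strip p l = None.
Proof.
  intros H; destruct (strip p l) as [u|] eqn:E; auto.
  apply strip_Some in E; destruct H; exists u; auto.
Qed.

(** [g] is indexed by positions relative to [p], so it can be built from a node alone. *)
Definition update_cone (ρ : position -> option node) (p : position)
    (g : position -> option node) (γ : position) : option node :=
  match strip p γ with Some η => g η | None => ρ γ end.

Lemma update_cone_in ρ p g η : update_cone ρ p g (p ++ η) = g η.
Proof. unfold update_cone; now rewrite strip_app. Qed.

Lemma update_cone_out ρ p g γ : ~ prefix p γ -> update_cone ρ p g γ = ρ γ.
Proof. intros H; unfold update_cone; now rewrite strip_None. Qed.

Lemma prefix_snoc (X : Type) (p l : list X) y :
  prefix p (l ++ [y]) -> p = l ++ [y] \/ prefix p l.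
Proof.
  intros [u E]; destruct u as [|z u _] using rev_ind.
  - left; now rewrite app_nil_r in E.
  - right; rewrite app_assoc in E; apply app_inj_tail in E as [E _].
    now exists u.
Qed.

Section Soundness.

Context {At : Type} {M : logic}.
Implicit Types (S : structure At M) (Γ Δ : list (pform At)) (P : pform At).

(** Iterating [f] yields the path on which a cone is laid out. In [D] the absence of leaves provides
    a child, chosen by [epsilon]; in [T] and [S4] reflexivity allows staying in place. *)
Lemma serial_step S : total_logic M ->
  exists f : node -> node, forall s, tree (smodel S) s ->
    tree (smodel S) (f s) /\ logic_rel M (tree (smodel S)) s (f s).
Proof.
  intros HM; destruct M eqn:EM; simpl in HM; try tauto.
  - exists (fun s => epsilon (inhabits []) (child (tree (smodel S)) s)).
    intros s Hs.
    pose proof (proj2 (smodelP S) eq_refl s Hs) as Hex.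
    pose proof (epsilon_spec (inhabits []) _ Hex) as Hc.
    split; [apply Hc | exact Hc].
  - exists (fun s => s); intros s Hs; split; [auto | apply r_refl].
  - exists (fun s => s); intros s Hs; split; [auto | apply rt_refl].
Qed.

(** In a total logic [η] is sent to the node reached from [t] after [length η] steps, so one more
    token is one more step. In a partial logic only the tip of the cone is interpreted, and the step
    condition is vacuous. *)
Lemma cone_assignment S t : tree (smodel S) t ->
  exists g : position -> option node,
    g [] = Some t
    /\ (forall η s, g η = Some s -> tree (smodel S) s)
    /\ (forall η θ, defined g (η ++ θ) -> defined g η)
    /\ (forall η y s u, g η = Some s -> g (η ++ [y]) = Some u ->
          logic_rel M (tree (smodel S)) s u)
    /\ (total_logic M -> forall η, defined g η).
Proof.
  intros Ht; destruct (classic (total_logic M)) as [HM|HM].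
  - destruct (serial_step S HM) as [f Hf].
    assert (Hit : forall n, tree (smodel S) (Nat.iter n f t)).
    { induction n; simpl; auto; now apply Hf. }
    exists (fun η => Some (Nat.iter (length η) f t)); repeat split.
    + intros η s [= <-]; apply Hit.
    + intros; eexists; reflexivity.
    + intros η y s u [= <-] [= <-].
      rewrite length_app, Nat.add_comm; simpl; apply Hf, Hit.
    + intros; eexists; reflexivity.
  - exists (fun η => match η with [] => Some t | _ => None end);
      repeat split; try tauto.
    + intros [|] s; congruence.
    + intros [|] θ [s Hs]; [exists t | exists s]; auto.
    + intros [|] y s u; simpl; congruence.
Qed.

(** Inside the cone the conditions come from [g], outside it from [rho S]; only positions straddling
    its border need an argument. *)
Lemma structure_update S α x s t :
  rho S α = Some s -> acc (smodel S) s t ->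
  exists S' : structure At M,
    smodel S' = smodel S
    /\ rho S' (α ++ [x]) = Some t
    /\ forall γ, ~ prefix (α ++ [x]) γ -> rho S' γ = rho S γ.
Proof.
  intros Hs Hacc.
  pose proof (proj2 (accP _ _ _ Hacc)) as Ht.
  destruct (cone_assignment S _ Ht) as (g & g0 & gtree & gpre & gstep & gtot).
  set (p := α ++ [x]); set (ρ' := update_cone (rho S) p g).
  assert (H1 : forall γ u, ρ' γ = Some u -> tree (smodel S) u).
  { intros γ u; destruct (classic (prefix p γ)) as [[η ->]|Hn]; unfold ρ'.
    - rewrite update_cone_in; apply gtree.
    - rewrite update_cone_out by auto; apply rho_tree. }
  assert (H2 : forall γ β, prefix β γ -> defined ρ' γ -> defined ρ' β).
  { intros γ β Hβ [u Hu]; unfold ρ' in *.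
    destruct (classic (prefix p β)) as [[η ->]|Hn].
    - destruct Hβ as [θ ->].
      rewrite <- app_assoc, update_cone_in in Hu.
      destruct (gpre η θ) as [v Hv]; [now exists u|].
      exists v; now rewrite update_cone_in.
    - unfold defined; rewrite update_cone_out by auto.
      destruct (classic (prefix p γ)) as [Hp|Hn'].
      (* Tokens are removed from the end of [γ]. Since [β] is outside the cone, it never equals the
         remaining position and survives as a prefix down to [α]. *)
      + assert (Hβα : prefix β α).
        { destruct Hp as [η ->]; clear Hu.
          induction η as [|z η IH] using rev_ind.
          - rewrite app_nil_r in Hβ; apply prefix_snoc in Hβ as [->|]; auto.
            destruct Hn; exists []; now rewrite app_nil_r.
          - rewrite app_assoc in Hβ; apply prefix_snoc in Hβ as [->|]; auto.
            destruct Hn; exists (η ++ [z]); now rewrite app_assoc. }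
        apply (rho_prefix S Hβα); now exists s.
      + rewrite update_cone_out in Hu by auto.
        apply (rho_prefix S Hβ); now exists u. }
  assert (H3 : forall γ y u v, ρ' γ = Some u -> ρ' (γ ++ [y]) = Some v ->
             logic_rel M (tree (smodel S)) u v).
  { intros γ y u v Hu Hv; unfold ρ' in *.
    destruct (classic (prefix p γ)) as [[η ->]|Hn].
    - rewrite <- app_assoc, update_cone_in in Hv.
      rewrite update_cone_in in Hu; eauto.
    - rewrite update_cone_out in Hu by auto.
      destruct (classic (prefix p (γ ++ [y]))) as [Hp|Hn'].
      (* The only step entering the cone is from [α] to [α ++ [x]], and there accessibility of [t]
         from [s] gives the relation. *)
      + apply prefix_snoc in Hp as [Hp|]; [|tauto].
        unfold p in Hp; apply app_inj_tail in Hp as [-> ->].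
        pose proof (update_cone_in (rho S) p g []) as Hnil.
        rewrite app_nil_r, g0 in Hnil; unfold p in *.
        assert (u = s) as -> by congruence; assert (v = t) as -> by congruence.
        now apply (proj1 (smodelP S)).
      + rewrite update_cone_out in Hv by auto; eapply rho_step; eauto. }
  assert (H4 : total_logic M -> forall γ, defined ρ' γ).
  { intros HM γ; unfold defined, ρ'.
    destruct (classic (prefix p γ)) as [[η ->]|Hn].
    - rewrite update_cone_in; now apply gtot.
    - rewrite update_cone_out by auto; now apply rho_total. }
  exists (@Structure At M (smodel S) ρ' (smodelP S) H1 H2 H3 H4); simpl; repeat split.
  - pose proof (update_cone_in (rho S) p g []) as Hnil.
    now rewrite app_nil_r, g0 in Hnil.
  - intros γ Hn; now apply update_cone_out.
Qed.

(** * Refutation of sequents *)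

(** Classically the negation of [satR], hence stronger than the negation of [satL]: the position
    must be interpreted. *)
Definition fails S P : Prop :=
  exists s, rho S (pf_pos P) = Some s /\ ~ forces (smodel S) s (pf_form P).

Definition refutes S Γ Δ : Prop :=
  Forall (satL S) Γ /\ Forall (fails S) Δ.

Lemma satL_or_fails S A α : defined (rho S) α ->
  satL S (A ^^ α) \/ fails S (A ^^ α).
Proof.
  intros [s Hs]; destruct (classic (forces (smodel S) s A));
    [left | right]; now exists s.
Qed.

Lemma satisfies_of_not_refutes S Γ Δ : ~ refutes S Γ Δ -> satisfies S Γ Δ.
Proof.
  intros H HΓ; apply NNPP; intros Hn; apply H; split; apply Forall_forall; auto.
  intros Q HQ; apply NNPP; intros Hf; apply Hn; exists Q; split; auto.
  intros s Hs; apply NNPP; intros Hnf; apply Hf; now exists s.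
Qed.

(** * Positions interpreted in a refuting structure *)

Lemma refutes_defined S Γ Δ A α :
  refutes S Γ Δ -> In (A ^^ α) (Γ ++ Δ) -> defined (rho S) α.
Proof.
  intros [HΓ HΔ] Hin.
  rewrite Forall_forall in HΓ, HΔ; apply in_app_iff in Hin as [Hin|Hin].
  - destruct (HΓ _ Hin) as (s & Hs & _); now exists s.
  - destruct (HΔ _ Hin) as (s & Hs & _); now exists s.
Qed.

(** The domain of [rho] is closed under prefixes and contains every position of a refuted
    sequent. *)
Lemma init_defined S Γ Δ α :
  refutes S Γ Δ -> init (Γ ++ Δ) α -> defined (rho S) α.
Proof.
  intros HR (A & β & Hin & Hp).
  exact (rho_prefix S Hp (refutes_defined _ _ HR Hin)).
Qed.

Lemma cut_side_defined S α Γ1 Δ1 Γ2 Δ2 :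
  cut_side M α Γ1 Δ1 Γ2 Δ2 -> refutes S Γ1 Δ1 -> refutes S Γ2 Δ2 ->
  defined (rho S) α.
Proof.
  intros Hc H1 H2; destruct (classic (total_logic M)) as [HM|HM].
  - now apply rho_total.
  - assert (Hi : init (Γ1 ++ Δ1) α \/ init (Γ2 ++ Δ2) α)
      by (clear H1 H2; destruct M; simpl in *; tauto).
    destruct Hi as [Hi|Hi];
      [exact (init_defined H1 Hi) | exact (init_defined H2 Hi)].
Qed.

(** One-token steps compose by transitivity, the intermediate positions being interpreted by prefix
    closure. It serves [K4] and [S4]. *)
Lemma rho_path S :
  (forall s t u, logic_rel M (tree (smodel S)) s t ->
     logic_rel M (tree (smodel S)) t u -> logic_rel M (tree (smodel S)) s u) ->
  forall α β s t, β <> [] -> rho S α = Some s -> rho S (α ++ β) = Some t ->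
    logic_rel M (tree (smodel S)) s t.
Proof.
  intros Htr α β; induction β as [|y β IH] using rev_ind; [congruence|].
  intros s t _ Hs Ht; rewrite app_assoc in Ht.
  destruct (list_eq_dec Nat.eq_dec β []) as [->|Hβ].
  - rewrite app_nil_r in Ht; eapply rho_step; eauto.
  - destruct (rho_prefix S (β := α ++ β) (α := (α ++ β) ++ [y])) as [u Hu];
      [now exists [y] | now exists t|].
    apply (Htr s u t); [now apply IH | eapply rho_step; eauto].
Qed.

Lemma modal_side_acc S α β Γ Δ s :
  modal_side M α β Γ Δ -> refutes S Γ Δ -> rho S α = Some s ->
  exists t, rho S (α ++ β) = Some t /\ acc (smodel S) s t.
Proof.
  intros Hm HR Hs.
  assert (Hd : defined (rho S) (α ++ β)).
  { destruct (classic (total_logic M)) as [HM|HM]; [now apply rho_total|].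
    apply (init_defined (Γ := Γ) (Δ := Δ) HR).
    assert (Ho : exists B η, In (B ^^ (α ++ β ++ η)) Γ \/
                             In (B ^^ (α ++ β ++ η)) Δ)
      by (clear HR; destruct M; simpl in *; tauto).
    destruct Ho as (B & η & Ho); exists B, (α ++ β ++ η); split.
    - now apply in_app_iff.
    - exists η; now rewrite app_assoc. }
  destruct Hd as [t Ht]; exists t; split; auto.
  apply (proj1 (smodelP S)).
  split; [eapply rho_tree; eauto|]; split; [eapply rho_tree; eauto|].
  pose proof (rho_step S) as Hstep; pose proof (rho_path S) as Hpath.
  clear HR.
  (* A single token is one step of [rho]; an empty [β] is settled by reflexivity in [T] and [S4]; in
     [K4] and [S4] a nonempty [β] is a path. *)
  destruct M; simpl in Hm.
  - destruct Hm as [[x ->] _]; eauto.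
  - destruct Hm as [x ->]; eauto.
  - destruct Hm as [->|[x ->]]; [|eauto].
    rewrite app_nil_r in Ht; assert (t = s) as -> by congruence; apply r_refl.
  - apply (Hpath (@t_trans _ _) α β); tauto.
  - destruct (list_eq_dec Nat.eq_dec β []) as [->|Hβ].
    + rewrite app_nil_r in Ht; assert (t = s) as -> by congruence.
      apply rt_refl.
    + now apply (Hpath (@rt_trans _ _) α β).
Qed.

(** Freshness says that no position of the sequent lies in the reinterpreted cone, so all its
    formulas keep their values. *)
Lemma refutes_update S Γ Δ α x s t :
  ~ init (Γ ++ Δ) (α ++ [x]) -> refutes S Γ Δ ->
  rho S α = Some s -> acc (smodel S) s t ->
  exists S' : structure At M, refutes S' Γ Δ /\ smodel S' = smodel S
    /\ rho S' (α ++ [x]) = Some t.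
Proof.
  intros Hfresh [HΓ HΔ] Hs Hacc.
  destruct (structure_update S α x t Hs Hacc) as (S' & Hmod & Ht & Hout).
  assert (Hsame : forall P, In P (Γ ++ Δ) ->
             rho S' (pf_pos P) = rho S (pf_pos P)).
  { intros [A γ] HP; apply Hout; intros Hp; apply Hfresh; now exists A, γ. }
  rewrite Forall_forall in HΓ, HΔ.
  exists S'; repeat split; auto; apply Forall_forall; intros P HP;
    unfold satL, fails; rewrite Hmod, Hsame by (apply in_app_iff; auto); auto.
  - now apply HΓ.
  - now apply HΔ.
Qed.

(** * Induction on derivations *)

Lemma refutes_snocL S Γ Δ P :
  refutes S (Γ ++ [P]) Δ <-> refutes S Γ Δ /\ satL S P.
Proof. unfold refutes; rewrite Forall_app, Forall_cons_iff; intuition. Qed.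

Lemma refutes_consR S Γ Δ P :
  refutes S Γ (P :: Δ) <-> refutes S Γ Δ /\ fails S P.
Proof. unfold refutes; rewrite Forall_cons_iff; intuition. Qed.

Lemma refutes_app S Γ1 Γ2 Δ1 Δ2 :
  refutes S (Γ1 ++ Γ2) (Δ1 ++ Δ2) <-> refutes S Γ1 Δ1 /\ refutes S Γ2 Δ2.
Proof. unfold refutes; rewrite !Forall_app; intuition. Qed.

Lemma derivable_not_refuted Γ Δ :
  derivable M Γ Δ -> forall S, ~ refutes S Γ Δ.
Proof.
  induction 1 as
    [A α | A α Γ1 Γ2 Δ1 Δ2 Hc _ IH1 _ IH2 | A α Γ Δ _ IH | A α Γ Δ _ IH
    | A α Γ Δ _ IH | A α Γ Δ _ IH | A α B β Γ1 Γ2 Δ _ IH | A α B β Γ Δ1 Δ2 _ IH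
    | A α Γ Δ _ IH | A α Γ Δ _ IH | A B α Γ Δ _ IH | A B α Γ Δ _ IH
    | A B α Γ1 Γ2 Δ1 Δ2 _ IH1 _ IH2 | A B α Γ1 Γ2 Δ1 Δ2 _ IH1 _ IH2
    | A B α Γ Δ _ IH | A B α Γ Δ _ IH | A B α Γ1 Γ2 Δ1 Δ2 _ IH1 _ IH2
    | A B α Γ Δ _ IH | A α β Γ Δ Hm _ IH | A α x Γ Δ Hf _ IH
    | A α x Γ Δ Hf _ IH | A α β Γ Δ Hm _ IH];
    intros S HR.
  - destruct HR as [HΓ HΔ].
    apply Forall_inv in HΓ as (s & Hs & Hy), HΔ as (s' & Hs' & Hn).
    simpl in *; congruence.
  - apply refutes_app in HR as [HR1 HR2].
    (* The cut formula has a truth value at its interpreted position: if true, the second premise is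
       refuted, if false, the first. *)
    destruct (satL_or_fails S A (cut_side_defined _ Hc HR1 HR2)).
    + apply (IH2 S), refutes_snocL; auto.
    + apply (IH1 S), refutes_consR; auto.
  - apply refutes_snocL in HR as [HR _]; eapply IH; eauto.
  - apply refutes_consR in HR as [HR _]; eapply IH; eauto.
  - apply (IH S); change [A ^^ α; A ^^ α] with ([A ^^ α] ++ [A ^^ α]).
    rewrite app_assoc, refutes_snocL; split; auto.
    now apply refutes_snocL in HR.
  - apply (IH S); rewrite refutes_consR; split; auto.
    now apply refutes_consR in HR.
  - apply (IH S); revert HR; unfold refutes.
    rewrite !Forall_app, !Forall_cons_iff; tauto.
  - apply (IH S); revert HR; unfold refutes.
    rewrite !Forall_app, !Forall_cons_iff; tauto.
  - apply refutes_snocL in HR as [HR (s & Hs & Hy)].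
    apply (IH S), refutes_consR; split; auto; now exists s.
  - apply refutes_consR in HR as [HR (s & Hs & Hn)].
    apply (IH S), refutes_snocL; split; auto; exists s; split; auto.
    now apply NNPP.
  - apply refutes_snocL in HR as [HR (s & Hs & Hy)].
    apply (IH S), refutes_snocL; split; auto; exists s; simpl in *; tauto.
  - apply refutes_snocL in HR as [HR (s & Hs & Hy)].
    apply (IH S), refutes_snocL; split; auto; exists s; simpl in *; tauto.
  - apply refutes_consR in HR as [HR (s & Hs & Hn)].
    apply refutes_app in HR as [HR1 HR2]; simpl in *.
    (* If [A] holds at [s], then [B] must fail there. *)
    destruct (satL_or_fails S A (ex_intro _ s Hs)) as [(s' & Hs' & Hy)|Hf].
    + apply (IH2 S), refutes_consR; split; auto; exists s; simpl in *.
      assert (s' = s) as -> by congruence; tauto.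
    + apply (IH1 S), refutes_consR; auto.
  - rewrite app_assoc in HR.
    apply refutes_snocL in HR as [HR (s & Hs & Hy)].
    apply refutes_app in HR as [HR1 HR2]; destruct Hy as [Hy|Hy].
    + apply (IH1 S), refutes_snocL; split; auto; now exists s.
    + apply (IH2 S), refutes_snocL; split; auto; now exists s.
  - apply refutes_consR in HR as [HR (s & Hs & Hn)].
    apply (IH S), refutes_consR; split; auto; exists s; simpl in *; tauto.
  - apply refutes_consR in HR as [HR (s & Hs & Hn)].
    apply (IH S), refutes_consR; split; auto; exists s; simpl in *; tauto.
  - rewrite app_assoc in HR.
    apply refutes_snocL in HR as [HR (s & Hs & Hy)].
    apply refutes_app in HR as [HR1 HR2]; simpl in *.
    destruct (satL_or_fails S A (ex_intro _ s Hs)) as [(s' & Hs' & HA)|Hf].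
    + apply (IH2 S), refutes_snocL; split; auto; exists s; simpl in *.
      assert (s' = s) as -> by congruence; tauto.
    + apply (IH1 S), refutes_consR; auto.
  - apply refutes_consR in HR as [HR (s & Hs & Hn)].
    apply imply_to_and in Hn as [HA HB].
    apply (IH S), refutes_consR; split; [|now exists s].
    apply refutes_snocL; split; auto; now exists s.
  - apply refutes_snocL in HR as [HR (s & Hs & Hy)].
    destruct (modal_side_acc _ _ Hm HR Hs) as (t & Ht & Hacc).
    apply (IH S), refutes_snocL; split; auto; exists t; split; auto.
  - apply refutes_consR in HR as [HR (s & Hs & Hn)].
    (* The accessible node [t] falsifying [A] becomes the value of the fresh position. *)
    apply not_all_ex_not in Hn as [t Hn].
    apply imply_to_and in Hn as [Hacc Hn].
    destruct (refutes_update _ _ t Hf HR Hs Hacc) as (S' & HR' & Hmod & Ht).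
    apply (IH S'), refutes_consR; split; auto.
    exists t; simpl; now rewrite Hmod.
  - apply refutes_snocL in HR as [HR (s & Hs & t & Hacc & Hy)].
    destruct (refutes_update _ _ t Hf HR Hs Hacc) as (S' & HR' & Hmod & Ht).
    apply (IH S'), refutes_snocL; split; auto.
    exists t; simpl; now rewrite Hmod.
  - apply refutes_consR in HR as [HR (s & Hs & Hn)].
    destruct (modal_side_acc _ _ Hm HR Hs) as (t & Ht & Hacc).
    apply (IH S), refutes_consR; split; auto; exists t; split; auto.
    (* Were [A] true at the value [t] of [α ++ β], then [t] would witness [Dia A] at [s]. *)
    intros HA; apply Hn; now exists t.
Qed.

End Soundness.

Unset Implicit Arguments.

Theorem mainTheorem5 (At : Type) (M : logic) (Γ Δ : list (pform At)) :
  derivable M Γ Δ -> entails M Γ Δ.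
Proof.
  intros H S; apply satisfies_of_not_refutes; now apply derivable_not_refuted.
Qed.
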